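(* Let $n>1$. In $K_n$ we have $S(f,n)=\{x\in K_n\mid c(x)\subseteq[n-1]\}$.
   Context: For a natural number $k$, $[k]=\{1,\dots,k\}$, and $[0]=\emptyset$. Kiselman's semigroup $K_n$ is the monoid, with unit element $e$, given by generators $a_1,\dots,a_n$ and relations $a_i^2=a_i$ for all $i\in[n]$, and $a_i a_j a_i = a_j a_i a_j = a_i a_j$ for all $1\le j<i\le n$. The element $f=a_na_{n-1}\cdots a_1$ is the zero element of $K_n$. The content $c(x)\subseteq[n]$ of $x\in K_n$ is the set of indices $i$ such that $a_i$ occurs in a word in the generators representing $x$ (it is independent of the chosen word). For $X\subseteq[n]$, the deletion endomorphism $\overline{\partial}_X:K_n\to K_n$ is the unique monoid endomorphism with $\overline{\partial}_X(a_i)=a_i$ if $i\notin X$ and $\overline{\partial}_X(a_i)=e$ if $i\in X$. The ultrametric $d$ on $K_n$ is $d(x,y)=\min\{i\in\{0,1,\dots,n\}\mid \overline{\partial}_{[i]}(x)=\overline{\partial}_{[i]}(y)\}$, and $S(a,r)=\{x\in K_n\mid d(a,x)=r\}$. *)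

(* Defs.v *)
From HB Require Import structures.
From mathcomp Require Import all_boot.
From mathcomp Require Import boolp classical_sets.

Set Implicit Arguments.
Unset Strict Implicit.
Unset Printing Implicit Defensive.

Local Open Scope group_scope.
Local Open Scope classical_set_scope.
Local Open Scope quotient_scope.

(* Ordinals are 0-based: i : 'I_n stands for the index i + 1 of [n], and       *)
(* accordingly the initial segment {1, ..., k} is the set of ordinals i < k.   *)
Definition initial_seg (n k : nat) : set 'I_n := [set i : 'I_n | (i < k)%N].
Arguments initial_seg n k : clear implicits.

(* The congruence on the free monoid of words generated by the relations.      *)
Inductive kcong (n : nat) : seq 'I_n -> seq 'I_n -> Prop :=
| kcong_refl u : kcong u u
| kcong_sym u v : kcong u v -> kcong v u
| kcong_trans v u w : kcong u v -> kcong v w -> kcong u w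
| kcong_cat u u' v v' : kcong u u' -> kcong v v' -> kcong (u ++ v) (u' ++ v')
| kcong_idem (i : 'I_n) : kcong [:: i; i] [:: i]
| kcong_iji (i j : 'I_n) : (j < i)%N -> kcong [:: i; j; i] [:: i; j]
| kcong_jij (i j : 'I_n) : (j < i)%N -> kcong [:: j; i; j] [:: i; j].

Section Kiselman.
Variable n : nat.

Definition kcongb : rel (seq 'I_n) := fun u v => `[< kcong u v >].

Lemma kcongb_refl : reflexive kcongb.
Proof. by move=> u; apply/asboolP; exact: kcong_refl. Qed.

Lemma kcongb_sym : symmetric kcongb.
Proof. by move=> u v; apply/asboolP/asboolP; exact: kcong_sym. Qed.

Lemma kcongb_trans : transitive kcongb.
Proof.
by move=> v u w /asboolP uv /asboolP vw; apply/asboolP; exact: kcong_trans vw.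
Qed.

Canonical kcongb_equiv := EquivRel kcongb kcongb_refl kcongb_sym kcongb_trans.

Definition kiselman := {eq_quot kcongb}.
HB.instance Definition _ := Choice.on kiselman.
HB.instance Definition _ := EqQuotient.on kiselman.

Definition kword (w : seq 'I_n) : kiselman := \pi_kiselman w.

Lemma kwordP u v : kword u = kword v <-> kcong u v.
Proof.
by rewrite /kword; split=> [/eqquotP/asboolP//|uv]; apply/eqquotP/asboolP.
Qed.

Lemma kwordK x : kword (repr x) = x.
Proof. exact: reprK. Qed.

Definition kone : kiselman := kword [::].
Definition kmul (x y : kiselman) : kiselman := kword (repr x ++ repr y).

Lemma kmul_word u v : kmul (kword u) (kword v) = kword (u ++ v).
Proof. by apply/kwordP/kcong_cat; apply/kwordP; rewrite kwordK. Qed.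

Lemma kmulA : associative kmul.
Proof.
by move=> x y z; rewrite -[x]kwordK -[y]kwordK -[z]kwordK !kmul_word catA.
Qed.

Lemma kmul1 : left_id kone kmul.
Proof. by move=> x; rewrite -[x]kwordK kmul_word. Qed.

Lemma kmulr1 : right_id kone kmul.
Proof. by move=> x; rewrite -[x]kwordK kmul_word cats0. Qed.

HB.instance Definition _ := isMonoid.Build kiselman kmulA kmul1 kmulr1.

Lemma kword_cat u v : kword (u ++ v) = kword u * kword v.
Proof. by rewrite -kmul_word. Qed.

Lemma kword_nil : kword [::] = 1. Proof. by []. Qed.

Definition kgen (i : 'I_n) : kiselman := kword [:: i].

Lemma kword_prod w : kword w = \prod_(i <- w) kgen i.
Proof.
elim: w => [|i w IH]; first by rewrite big_nil.
by rewrite big_cons -IH -kword_cat.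
Qed.

Definition kiselman_rels (M : monoidType) (g : 'I_n -> M) : Prop :=
  (forall i, g i * g i = g i) /\
  (forall i j : 'I_n, (j < i)%N ->
     g i * g j * g i = g i * g j /\ g j * g i * g j = g i * g j).

Lemma kgen_rels : kiselman_rels kgen.
Proof.
have e2 i j : kgen i * kgen j = kword [:: i; j].
  by rewrite kword_prod !big_cons big_nil mulg1.
have e3 i j k : kgen i * kgen j * kgen k = kword [:: i; j; k].
  by rewrite kword_prod !big_cons big_nil mulg1 mulgA.
split=> [i|i j ji]; first by rewrite e2; apply/kwordP/kcong_idem.
by rewrite !e3 e2; split; apply/kwordP; [exact: kcong_iji|exact: kcong_jij].
Qed.

(* The map induced on the presented monoid by an assignment g of the           *)
(* generators; it is meaningful only when g satisfies the defining relations.  *)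
Definition klift (M : monoidType) (g : 'I_n -> M) (x : kiselman) : M :=
  \prod_(i <- repr x) g i.

Section Lift.
Variables (M : monoidType) (g : 'I_n -> M).

Lemma kcong_prod : kiselman_rels g ->
  forall u v, kcong u v -> \prod_(i <- u) g i = \prod_(i <- v) g i.
Proof.
case=> gid gij u v; elim=> //.
- by move=> {}v {}u w _ -> _ ->.
- by move=> {}u u' {}v v' _ eu _ ev; rewrite !big_cat /= eu ev.
- by move=> i; rewrite !big_cons big_nil !mulg1.
- by move=> i j /gij[h _]; rewrite !big_cons big_nil !mulg1 mulgA.
- by move=> i j /gij[_ h]; rewrite !big_cons big_nil !mulg1 mulgA.
Qed.

Lemma klift_word : kiselman_rels g ->
  forall w, klift g (kword w) = \prod_(i <- w) g i.
Proof.
by move=> gP w; apply: (kcong_prod gP); apply/kwordP; rewrite kwordK.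
Qed.

Lemma klift_gen : kiselman_rels g -> forall i, klift g (kgen i) = g i.
Proof. by move=> gP i; rewrite klift_word // big_seq1. Qed.

Lemma klift_morphism : kiselman_rels g -> monoid_morphism (klift g).
Proof.
move=> gP; split=> [|x y]; first by rewrite -kword_nil klift_word // big_nil.
by rewrite -[x]kwordK -[y]kwordK -kword_cat !klift_word // big_cat.
Qed.

Lemma klift_unique (h : kiselman -> M) :
  monoid_morphism h -> (forall i, h (kgen i) = g i) -> h =1 klift g.
Proof.
case=> h1 hM hg x; rewrite -{1}[x]kwordK /klift.
elim: (repr x) => [|i w IH]; first by rewrite kword_nil big_nil.
by rewrite big_cons -IH -hg -hM -kword_cat.
Qed.

End Lift.

Definition deletion (X : set 'I_n) : kiselman -> kiselman :=
  klift (fun i => if i \in X then 1 else kgen i).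

Lemma deletion_rels (X : set 'I_n) :
  kiselman_rels (fun i => if i \in X then 1 else kgen i).
Proof.
have [gid gij] := kgen_rels; split=> [i|i j ji].
  by case: ifP => _; rewrite ?mulg1.
have [h1 h2] := gij _ _ ji.
by do 2!case: ifP => _; rewrite ?mulg1 ?mul1g.
Qed.

HB.instance Definition _ X := isUMagmaMorphism.Build kiselman kiselman
  (deletion X) (klift_morphism (deletion_rels X)).

Lemma deletion_gen (X : set 'I_n) i :
  deletion X (kgen i) = if i \in X then 1 else kgen i.
Proof. by rewrite /deletion klift_gen //; exact: deletion_rels. Qed.

Lemma deletion_unique (X : set 'I_n) (h : kiselman -> kiselman) :
  monoid_morphism h ->
  (forall i, h (kgen i) = if i \in X then 1 else kgen i) -> h =1 deletion X.
Proof. exact: klift_unique. Qed.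

Definition content (x : kiselman) : set 'I_n :=
  [set i | exists2 w : seq 'I_n, kword w = x & i \in w].

Lemma kcong_mem (u v : seq 'I_n) : kcong u v -> u =i v.
Proof.
elim=> //.
- by move=> {}u {}v _ h i; rewrite h.
- by move=> {}v {}u w _ h1 _ h2 i; rewrite h1 h2.
- by move=> {}u u' {}v v' _ h1 _ h2 i; rewrite !mem_cat h1 h2.
- by move=> i k; rewrite !inE orbb.
- by move=> i j _ k; rewrite !inE; do 2!case: (k == _).
- by move=> i j _ k; rewrite !inE; do 2!case: (k == _).
Qed.

Lemma content_word w : content (kword w) = [set i | i \in w].
Proof.
apply/seteqP; split=> [i [u /kwordP/kcong_mem uw]|i iw]; first by rewrite /= uw.
by exists w.
Qed.

(* a_n ... a_2 a_1 *)
Definition kzero : kiselman := \prod_(i < n) kgen (rev_ord i).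

(* The bound ord_max (that is, n) is always an admissible value: kdist_max.    *)
Definition kdist (x y : kiselman) : nat :=
  [arg min_(i < ord_max : 'I_n.+1 |
     deletion (initial_seg n i) x == deletion (initial_seg n i) y) (i : nat)].

Lemma kdist_max x y :
  deletion (initial_seg n n) x == deletion (initial_seg n n) y.
Proof.
have del1 z : deletion (initial_seg n n) z = 1.
  rewrite /deletion /klift big1 // => i _.
  by rewrite mem_set //; exact: ltn_ord.
by rewrite !del1.
Qed.

Definition ksphere (a : kiselman) (r : nat) : set kiselman :=
  [set x | kdist a x = r].

End Kiselman.

(* Main.v *)
Require Import Defs.
From mathcomp Require Import all_boot.
From mathcomp Require Import boolp classical_sets.

(** For [k < n] the deletion of [[k]] keeps the top generator [a_n]. If [a_n] is
    not in the content of [x], it therefore occurs in every such deletion of [f]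
    and in none of [x], so the two never agree before [k = n]. If it is, deleting
    [[n-1]] sends both [f] and [x] to a positive power of the idempotent [a_n]. *)

Lemma deletion_word (n : nat) (X : set 'I_n) (w : seq 'I_n) :
  deletion X (kword w) = kword [seq i <- w | i \notin X].
Proof.
rewrite /deletion klift_word; last exact: deletion_rels.
rewrite kword_prod big_filter [RHS]big_mkcond.
by apply: eq_bigr => i _; case: (i \in X).
Qed.

(** Deletion filters a representing word, so both directions below can argue on contents alone. *)
Lemma content_deletion (n : nat) (X : set 'I_n) (x : kiselman n) :
  content (deletion X x) = (content x `\` X)%classic.
Proof.
rewrite -[x]kwordK deletion_word !content_word.
apply/seteqP; split=> i /=; rewrite mem_filter.
  by move=> /andP[/negP iX ->]; split=> // /mem_set.
by move=> [-> iX]; rewrite memNset.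
Qed.

(** A word with [i] as its only letter is a power of [kgen i], positive because [i] does occur;
    idempotence collapses it. *)
Lemma content_eq1 (n : nat) (i : 'I_n) (x : kiselman n) :
  content x = [set i]%classic -> x = kgen i.
Proof.
rewrite -[x]kwordK content_word; move: (repr x) => w /seteqP[wi iw].
have {iw} : i \in w by apply: iw.
have {wi} /all_pred1P -> : all (pred1 i) w by apply/allP => j /wi /= ->.
case: (size w) => // m _; elim: m => // m IHm.
rewrite -[nseq _ _]/([:: i] ++ nseq m.+1 i) kword_cat IHm.
by case: (kgen_rels n) => ->.
Qed.

Lemma content_kzero (n : nat) : content (kzero n) = [set: 'I_n]%classic.
Proof.
have -> : kzero n = kword [seq rev_ord i | i <- index_enum 'I_n].
  by rewrite kword_prod big_map.
rewrite content_word; apply/seteqP; split=> // i _ /=.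
by rewrite -[i]rev_ordK map_f // mem_index_enum.
Qed.

(** The minimum is over [0..n] and [n] always qualifies, so it is [n] exactly when no smaller [k]
    does. *)
Lemma kdist_eq_max (n : nat) (x y : kiselman n) :
  kdist x y = n <->
  forall k, (k < n)%N ->
    deletion (initial_seg n k) x <> deletion (initial_seg n k) y.
Proof.
rewrite /kdist; case: arg_minnP => [|i eqi mini]; first exact: kdist_max.
split=> [ein k kn /eqP eqk | neq].
  have := mini (Ordinal (ltnW kn : (k < n.+1)%N)) eqk.
  by rewrite ein leqNgt kn.
apply/eqP; rewrite eqn_leq -ltnS ltn_ord leqNgt; apply/negP => /neq.
by apply; apply/eqP.
Qed.

Theorem proposition7p4 (n : nat) (hn : (1 < n)%N) :
  ksphere (kzero n) n
  = [set x : kiselman n | (content x `<=` initial_seg n n.-1)%classic]%classic.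
Proof.
case: n hn => // n _; apply/seteqP; split=> x /=.
  (* With [n.+1] generators, deleting the first [n] spares only the top one, the ordinal of value
     [n]. *)
  move=> /kdist_eq_max/(_ n (leqnn _)) neq i xi; rewrite /initial_seg /=.
  rewrite ltn_neqAle -ltnS ltn_ord andbT; apply/eqP => ein; apply: neq.
  have top (y : kiselman n.+1) : content y i ->
      deletion (initial_seg n.+1 n) y = kgen i.
    move=> yi; apply: content_eq1; rewrite content_deletion.
    apply/seteqP; split=> [j [_ /negP]|_ ->] /=.
      rewrite -leqNgt => nj; apply/val_inj/eqP.
      by rewrite /= eqn_leq ein nj -ltnS ltn_ord.
    by split=> //; rewrite /initial_seg /= ein ltnn.
  by rewrite !top // content_kzero.
(* Equal deletions would have equal contents; [ord_max] survives in that of [kzero] since [k <= n],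
   yet [xsub] bars it from that of [x]. *)
move=> xsub; apply/kdist_eq_max => k kn /(congr1 (@content _)).
rewrite !content_deletion content_kzero => /seteqP[/(_ ord_max) + _].
case; first by split=> //; rewrite /initial_seg /= ltnNge -ltnS kn.
by move=> /xsub; rewrite /initial_seg /= ltnn.
Qed.
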